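(* Let $(Y,d')$ be a metric space, let $X_1,X_2\subset Y$, and let $f_1:X_1\to\mathbb{R}^n$, $f_2:X_2\to\mathbb{R}^n$ be functions. Then for any $i\in\mathbb{Z}_{\ge0}$, $$d_I\big(H_i\circ F^{SO}(X_1,Y,d',f_1),\,H_i\circ F^{SO}(X_2,Y,d',f_2)\big)\le d^{SO}_{(Y,d')}\big((X_1,Y,d',f_1),(X_2,Y,d',f_2)\big).$$
   Context: Fix a field $k$ and $n\ge1$. For $N\ge 1$, $B_N=k[\mathbb{R}_{\ge0}^N]$ is the monoid ring of $(\mathbb{R}^N_{\ge0},+)$. A $B_N$-persistence module is a $B_N$-module $M$ with a $k$-vector space decomposition $M=\bigoplus_{a\in\mathbb{R}^N}M_a$ such that $x_i^{\alpha}(M_a)\subset M_{a+\alpha \mathbf{e}_i}$ for all $a$, $\alpha\ge0$; morphisms are module homomorphisms $f$ with $f(M_a)\subset M'_a$. For $a\le b$ (product order) the transition map $\varphi_M(a,b):M_a\to M_b$ is multiplication by $x_1^{b_1-a_1}\cdots x_N^{b_N-a_N}$. For $\epsilon\ge0$ let $\vec\epsilon=(\epsilon,\dots,\epsilon)$, $M(\epsilon)_a=M_{a+\vec\epsilon}$, $f(\epsilon)_a=f_{a+\vec\epsilon}$, and $S(M,\epsilon):M\to M(\epsilon)$ with $S(M,\epsilon)_a=\varphi_M(a,a+\vec\epsilon)$. $M,M'$ are $\epsilon$-interleaved if there are morphisms $f:M\to M'(\epsilon)$, $g:M'\to M(\epsilon)$ with $g(\epsilon)\circ f=S(M,2\epsilon)$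 and $f(\epsilon)\circ g=S(M',2\epsilon)$. $d_I(M,M')=\inf\{\epsilon\ge0: M,M'\text{ are }\epsilon\text{-interleaved}\}\in[0,\infty]$. Sublevelset-offset filtration: for $X\subset Y$ and $f:X\to\mathbb{R}^n$ write $f_a=\{x\in X: f(x)\le a\}$; $F^{SO}(X,Y,d',f)$ is the filtration indexed by $(a,b)\in\mathbb{R}^n\times\mathbb{R}=\mathbb{R}^{n+1}$ with $F^{SO}(X,Y,d',f)_{(a,b)}=\{y\in Y: d'(y,f_a)\le b\}$ and inclusions as transition maps. $H_i$ is the $i$-th persistent homology functor: $H_i(F)_c$ is the singular homology $H_i(F_c;k)$ with transition maps induced by those of $F$ (here a $B_{n+1}$-persistence module). The distance on quadruples is $$d^{SO}_{(Y,d')}\big((X_1,Y,d',f_1),(X_2,Y,d',f_2)\big)=\max\Big\{\sup_{x_1\in X_1}\inf_{x_2\in X_2}\max\big(d'(x_1,x_2),\|f_1(x_1)-f_2(x_2)\|_\infty\big),\ \sup_{x_2\in X_2}\inf_{x_1\in X_1}\max\big(d'(x_1,x_2),\|f_1(x_1)-f_2(x_2)\|_\infty\big)\Big\}.$$ *)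

(* Defs.v *)
From HB Require Import structures.
From mathcomp Require Import all_boot all_order all_algebra finmap.
From mathcomp Require Import all_classical all_reals.
From mathcomp Require Import interval_inference ereal topology normedtype.
(* The notations of monalg clash with those of MathComp-Analysis:
   [malg K G] is the type {malg G[K]} of finitely supported maps K -> G,
   [mkmalgU x c] is c times the basis element x, and [mcoeff x g] is the
   coefficient of g at x. *)
From mathcomp Require Import -(notations) monalg.

Set Implicit Arguments.
Unset Strict Implicit.
Unset Printing Implicit Defensive.

Import Order.TTheory GRing.Theory Num.Theory.
Import numFieldNormedType.Exports.

Local Open Scope classical_set_scope.
Local Open Scope ring_scope.

Section FreeModule.
Variables (k : fieldType) (S : choiceType) (V : lmodType k).

Definition lext (f : S -> V) (c : malg S k) : V :=
  \sum_(s <- msupp c) mcoeff s c *: f s.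

Lemma lextEw f (d : {fset S}) c : (msupp c `<=` d)%fset ->
  lext f c = \sum_(s <- d) mcoeff s c *: f s.
Proof.
move=> le; rewrite /lext; apply: big_fset_incl => // s _ /mcoeff_outdom ->.
by rewrite scale0r.
Qed.

Lemma lext_is_linear f : linear (lext f).
Proof.
move=> a c1 c2; pose d := (msupp c1 `|` msupp c2)%fset.
have l1 : (msupp c1 `<=` d)%fset by exact: fsubsetUl.
have l2 : (msupp c2 `<=` d)%fset by exact: fsubsetUr.
rewrite (@lextEw f d (a *: c1 + c2)); last first.
  apply: (fsubset_trans (msuppD_le _ _)); rewrite fsubUset l2 andbT.
  exact: fsubset_trans (msuppZ_le _ _) l1.
rewrite (lextEw f l1) (lextEw f l2) scaler_sumr -big_split /=.
by apply: eq_bigr => s _; rewrite mcoeffD mcoeffZ scalerDl scalerA.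
Qed.

HB.instance Definition _ f :=
  GRing.isLinear.Build k (malg S k) V *:%R (lext f) (lext_is_linear f).

Lemma lextU f s a : lext f (mkmalgU s a) = a *: f s.
Proof.
by rewrite (lextEw f (d := [fset s]%fset)) ?msuppU_le// big_seq_fset1 mcoeffUU.
Qed.

Lemma malg_linear_ext (f g : {linear malg S k -> V}) :
  (forall s, f (mkmalgU s 1) = g (mkmalgU s 1)) -> f =1 g.
Proof.
move=> fg c; rewrite (monalgE c) !linear_sum /=; apply: eq_bigr => s _.
have -> : mkmalgU s (mcoeff s c) = mcoeff s c *: mkmalgU s 1.
  by apply/malgP => t; rewrite mcoeffZ !mcoeffU mulrnAr mulr1.
by rewrite !linearZ /= fg.
Qed.

End FreeModule.

Section Subquotients.
Variables (k : fieldType) (V : lmodType k).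

Record subspace := Subspace {
  subspace_mem :> V -> bool;
  subspace_closed : submod_closed subspace_mem
}.

HB.instance Definition _ (W : subspace) :=
  GRing.isSubmodClosed.Build k V (subspace_mem W) (subspace_closed W).

Variable W : subspace.

Definition sub_module : Type := {x : V | subspace_mem W x}.
HB.instance Definition _ := SubChoice.on sub_module.
HB.instance Definition _ := [SubChoice_isSubLmodule of sub_module by <:].

Definition zsubspace := GRing.ZmodClosed.clone V (subspace_mem W) _.

Definition quot_module : Type := Quotient.quot zsubspace.
HB.instance Definition _ := GRing.Zmodule.on quot_module.

Definition qpi (x : V) : quot_module := (\pi_(Quotient.quot zsubspace) x)%qT.
Definition qrepr (x : quot_module) : V := repr (x : Quotient.quot zsubspace).

Lemma qreprK : cancel qrepr qpi.
Proof. by move=> x; rewrite /qpi /qrepr reprK. Qed.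

Lemma qpi_eqP x y : qpi x = qpi y <-> subspace_mem W (x - y).
Proof.
have E : (x - y \in zsubspace) = (qpi x == qpi y) by exact: Quotient.idealrBE.
by split => [/eqP|H]; rewrite ?[LHS]E -?E //; apply/eqP; rewrite -E.
Qed.

Lemma qpiB : {morph qpi : x y / x - y}.
Proof. by move=> x y; exact: (raddfB (\pi_(Quotient.quot zsubspace))%qT). Qed.

Definition qscale (a : k) (x : quot_module) : quot_module :=
  qpi (a *: qrepr x).

Lemma subspaceZ a x : subspace_mem W x -> subspace_mem W (a *: x).
Proof.
have [W0 WZ] := subspace_closed W => Wx.
by have := WZ a x 0 Wx W0; rewrite addr0.
Qed.

Lemma qscaleE a x : qscale a (qpi x) = qpi (a *: x).
Proof.
by apply/qpi_eqP; rewrite -scalerBr; apply/subspaceZ/qpi_eqP; rewrite qreprK.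
Qed.

Lemma qpi0 : qpi 0 = 0.
Proof. by have := qpiB 0 0; rewrite !subrr. Qed.

Lemma qpiD : {morph qpi : x y / x + y}.
Proof.
by move=> x y; rewrite -{1}[y]opprK -[- y]sub0r !qpiB qpi0 sub0r opprK.
Qed.

Lemma qscaleA a b x : qscale a (qscale b x) = qscale (a * b) x.
Proof. by rewrite -[x]qreprK !qscaleE scalerA. Qed.

Lemma qscale1 : left_id 1 qscale.
Proof. by move=> x; rewrite -[x]qreprK qscaleE scale1r. Qed.

Lemma qscaleDr : right_distributive qscale +%R.
Proof.
by move=> a x y; rewrite -[x]qreprK -[y]qreprK -qpiD !qscaleE scalerDr qpiD.
Qed.

Lemma qscaleDl x : {morph qscale^~ x : a b / a + b}.
Proof. by move=> a b; rewrite -[x]qreprK !qscaleE scalerDl qpiD. Qed.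

HB.instance Definition _ := GRing.Zmodule_isLmodule.Build k quot_module
  qscaleA qscale1 qscaleDr qscaleDl.

Lemma qpi_is_linear : linear qpi.
Proof. by move=> a x y; rewrite qpiD -qscaleE. Qed.

HB.instance Definition _ :=
  GRing.isLinear.Build k V quot_module *:%R qpi qpi_is_linear.

End Subquotients.

Arguments qpi {k V} W x.
Arguments qrepr {k V W} x.

Section QuotientMap.
Variables (k : fieldType) (V V' : lmodType k).
Variables (W : subspace V) (W' : subspace V') (f : {linear V -> V'}).
Hypothesis fW : forall x, W x -> W' (f x).

Definition qmap (x : quot_module W) : quot_module W' := qpi W' (f (qrepr x)).

Lemma qmapE x : qmap (qpi W x) = qpi W' (f x).
Proof.
by apply/qpi_eqP; rewrite -linearB; apply/fW/qpi_eqP; rewrite qreprK.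
Qed.

Lemma qmap_is_linear : linear qmap.
Proof.
move=> a x y; rewrite -[x]qreprK -[y]qreprK -linearP !qmapE.
by rewrite 2!linearP.
Qed.

End QuotientMap.

Section KernelImage.
Variables (k : fieldType) (U V : lmodType k) (f : {linear U -> V}).

Lemma ker_closed : submod_closed (fun x : U => f x == 0).
Proof.
split=> [|a x y /eqP fx /eqP fy]; first by rewrite /in_mem/= linear0.
by rewrite /in_mem /= linearP fx fy scaler0 addr0.
Qed.
Definition ker_of : subspace U := Subspace ker_closed.

Lemma im_closed : submod_closed (fun y : V => `[< exists x, f x = y >]).
Proof.
split=> [|a _ _ /asboolP[x <-] /asboolP[y <-]]; apply/asboolP.
  by exists 0; rewrite linear0.
by exists (a *: x + y); rewrite linearP.
Qed.
Definition image_of : subspace V := Subspace im_closed.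

Variable W : subspace V.
Lemma restrict_closed :
  submod_closed (fun z : sub_module W => image_of (val z)).
Proof.
have [h0 hD] := im_closed.
split=> [|a x y]; first exact: h0.
move=> hx hy; have := hD a _ _ hx hy.
by rewrite (_ : a *: val x + val y = val (a *: x + y)).
Qed.
(* The elements of W, seen in W, that lie in the image of f. *)
Definition image_in : subspace (sub_module W) := Subspace restrict_closed.

End KernelImage.

Definition stdsimplex (R : realType) (p : nat) : set 'rV[R]_p.+1 :=
  [set t | (forall j, 0 <= t ord0 j) /\ \sum_j t ord0 j = 1].
Arguments stdsimplex : clear implicits.

Section Face.
Variables (R : realType) (p : nat) (j : 'I_p.+2).

(* The j-th face map in barycentric coordinates: insert a 0 at position j. *)
Definition insert0 (t : 'rV[R]_p.+1) : 'rV[R]_p.+2 :=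
  \row_i (if unlift j i is Some l then t ord0 l else 0).

Lemma insert0_simplex t : stdsimplex R p t -> stdsimplex R p.+1 (insert0 t).
Proof.
move=> [t0 t1]; split=> [i|].
  by rewrite mxE; case: (unlift j i).
rewrite (bigD1_ord j) //= mxE unlift_none add0r -t1.
by apply: eq_bigr => i _; rewrite mxE liftK.
Qed.

Definition face_fun (t : stdsimplex R p) : stdsimplex R p.+1 :=
  SigSub (mem_set (insert0_simplex (set_valP t))).

Lemma insert0_continuous : continuous insert0.
Proof.
move=> u A /nbhs_ballP[e /= e0 eA]; apply/nbhs_ballP; exists e => //= v [_ uv].
apply: eA; split => // i l; rewrite !mxE.
by case: (unlift j l) => [m|]; [exact: uv|exact: ballxx].
Qed.

Lemma face_continuous : continuous face_fun.
Proof.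
apply: continuous_comp_initial.
rewrite (_ : _ \o _ = insert0 \o set_val); last exact/funext.
move=> t; apply: continuous_comp; last exact: insert0_continuous.
exact: initial_continuous.
Qed.

HB.instance Definition _ := isContinuous.Build _ _ face_fun face_continuous.
Definition face : continuousType (stdsimplex R p) (stdsimplex R p.+1) :=
  face_fun.

End Face.

Section Inclusion.
Variables (Y : topologicalType) (A B : set Y) (AB : A `<=` B).

Definition incl_fun (x : A) : B := SigSub (mem_set (AB (set_valP x))).

Lemma incl_continuous : continuous incl_fun.
Proof.
apply: continuous_comp_initial.
rewrite (_ : _ \o _ = set_val); last exact/funext.
exact: initial_continuous.
Qed.

HB.instance Definition _ := isContinuous.Build _ _ incl_fun incl_continuous.
Definition incl : continuousType A B := incl_fun.

End Inclusion.

Section SingularHomology.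
Variables (k : fieldType) (R : realType).

Definition singular_simplex (p : nat) (T : topologicalType) : Type :=
  continuousType (stdsimplex R p) T.
HB.instance Definition _ p T := Choice.on (singular_simplex p T).

Definition scomp p (T T' : topologicalType) (g : continuousType T T')
  (s : singular_simplex p T) : singular_simplex p T' :=
  [the continuousType _ _ of g \o s].

Definition sface p (T : topologicalType) (j : 'I_p.+2)
  (s : singular_simplex p.+1 T) : singular_simplex p T :=
  [the continuousType _ _ of s \o face R j].

Definition singular_chain (p : nat) (T : topologicalType) :=
  malg (singular_simplex p T) k.

Definition bd p T : singular_chain p.+1 T -> singular_chain p T :=
  lext (fun s => \sum_(j < p.+2) (-1) ^+ j *: mkmalgU (sface j s) (1 : k)).
HB.instance Definition _ p T := GRing.Linear.on (@bd p T).

(* The differential out of degree p, which is zero when p = 0. *)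
Definition bdz p T : singular_chain p T -> singular_chain p.-1 T :=
  if p is p'.+1 then @bd p' T else \0.

Lemma bdz_is_linear p T : linear (@bdz p T).
Proof. by case: p => [|p]; exact: linearP. Qed.
HB.instance Definition _ p T :=
  GRing.isLinear.Build k (singular_chain p T) (singular_chain p.-1 T) *:%R
    (@bdz p T) (@bdz_is_linear p T).

Definition cycles p T : subspace (singular_chain p T) := ker_of (@bdz p T).
Definition cycle_space p T : lmodType k := sub_module (cycles p T).

(* As bdz \o bd = 0, these are all the images under [bd p]. *)
Definition boundaries p T : subspace (cycle_space p T) :=
  image_in (@bd p T) (cycles p T).

Definition homology p T : lmodType k := quot_module (boundaries p T).

Section Functoriality.
Variables (p : nat) (T T' : topologicalType) (g : continuousType T T').

Definition push : singular_chain p T -> singular_chain p T' :=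
  lext (fun s => mkmalgU (scomp g s) (1 : k)).
HB.instance Definition _ := GRing.Linear.on push.

Lemma pushU s a : push (mkmalgU s a) = mkmalgU (scomp g s) a.
Proof.
by rewrite /push lextU; apply/malgP=> t; rewrite mcoeffZ !mcoeffU mulrnAr mulr1.
Qed.

End Functoriality.

Lemma bd_push p (T T' : topologicalType) (g : continuousType T T')
    (c : singular_chain p.+1 T) :
  bd (push g c) = push g (bd c).
Proof.
apply: (@malg_linear_ext k _ _ [the {linear _ -> _} of @bd p T' \o push g]
  [the {linear _ -> _} of push g \o @bd p T]) => s /=.
rewrite pushU /bd !lextU !scale1r linear_sum; apply: eq_bigr => j _.
by rewrite linearZ /= pushU; congr (_ *: mkmalgU _ _); exact/continuousEP.
Qed.

Lemma push_cycle p (T T' : topologicalType) (g : continuousType T T')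
    (c : singular_chain p T) :
  cycles p T c -> cycles p T' (push g c).
Proof.
case: p c => [|p] c; first by rewrite /cycles /=.
by rewrite /cycles /= => /eqP c0; rewrite bd_push c0 linear0.
Qed.

Definition pushZ p (T T' : topologicalType) (g : continuousType T T')
    (z : cycle_space p T) : cycle_space p T' :=
  Sub (push g (val z)) (push_cycle g (valP z)).

Lemma pushZ_is_linear p (T T' : topologicalType) (g : continuousType T T') :
  linear (pushZ (p := p) g).
Proof. by move=> a x y; apply: val_inj; rewrite /= !linearP. Qed.

HB.instance Definition _ p (T T' : topologicalType) (g : continuousType T T') :=
  GRing.isLinear.Build k (cycle_space p T) (cycle_space p T') *:%R
    (pushZ g) (@pushZ_is_linear p T T' g).

Lemma pushZ_boundary p (T T' : topologicalType) (g : continuousType T T')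
    (z : cycle_space p T) :
  boundaries p T z -> boundaries p T' (pushZ g z).
Proof.
move=> /asboolP[w wz]; apply/asboolP; exists (push g w).
exact: etrans (bd_push g w) (congr1 (push g) wz).
Qed.

Definition hmap p (T T' : topologicalType) (g : continuousType T T') :
  homology p T -> homology p T' :=
  qmap (boundaries p T') (pushZ g).

HB.instance Definition _ p (T T' : topologicalType) (g : continuousType T T') :=
  GRing.isLinear.Build k (homology p T) (homology p T') *:%R
    (hmap g) (qmap_is_linear (@pushZ_boundary p T T' g)).

Lemma hmap_id p (T : topologicalType) (g : continuousType T T) : g =1 id ->
  hmap (p := p) g =1 id.
Proof.
move=> gid x; rewrite -[x]qreprK /hmap qmapE; last exact: pushZ_boundary.
congr qpi; apply: val_inj => /=.
apply: (@malg_linear_ext k _ _ _ [the {linear _ -> _} of idfun]) => s /=.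
by rewrite pushU; congr mkmalgU; apply/continuousEP => t /=; rewrite gid.
Qed.

Lemma hmap_comp p (T1 T2 T3 : topologicalType) (g : continuousType T1 T2)
    (h : continuousType T2 T3) (l : continuousType T1 T3) : h \o g =1 l ->
  forall x : homology p T1, hmap h (hmap g x) = hmap l x.
Proof.
move=> hgl x; rewrite -[x]qreprK /hmap !qmapE; try exact: pushZ_boundary.
congr qpi; apply: val_inj => /=.
apply: (@malg_linear_ext k _ _ [the {linear _ -> _} of push h \o push g]) => s /=.
by rewrite !pushU; congr mkmalgU; apply/continuousEP => t /=; rewrite -hgl.
Qed.

End SingularHomology.

Section MonoidRing.
Variables (R : realType) (N : nat).

(* The additive monoid R_{>=0}^N; [monomType] writes its law as a product. *)
Definition orthant : Type := {v : 'rV[R]_N | [forall i, 0 <= v ord0 i]}.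
HB.instance Definition _ := SubChoice.on orthant.

Lemma orthant_ge0 (v : orthant) i : 0 <= val v ord0 i.
Proof. exact: (forallP (valP v)). Qed.

Lemma orthant0_subproof : [forall i, 0 <= (0 : 'rV[R]_N) ord0 i].
Proof. by apply/forallP => i; rewrite mxE. Qed.
Definition orthant0 : orthant := Sub 0 orthant0_subproof.

Lemma orthantD_subproof (v w : orthant) :
  [forall i, 0 <= (val v + val w) ord0 i].
Proof. by apply/forallP => i; rewrite mxE addr_ge0 ?orthant_ge0. Qed.
Definition orthantD (v w : orthant) : orthant :=
  Sub (val v + val w) (orthantD_subproof v w).

Lemma orthantDA : associative orthantD.
Proof. by move=> u v w; apply: val_inj; rewrite /= addrA. Qed.

Lemma orthantDC : commutative orthantD.
Proof. by move=> v w; apply: val_inj; rewrite /= addrC. Qed.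

Lemma orthant0D : left_id orthant0 orthantD.
Proof. by move=> v; apply: val_inj; rewrite /= add0r. Qed.

Lemma orthantD0 : right_id orthant0 orthantD.
Proof. by move=> v; apply: val_inj; rewrite /= addr0. Qed.

Lemma orthant_unit v w :
  orthantD v w = orthant0 -> v = orthant0 /\ w = orthant0.
Proof.
move=> /(congr1 val) /= /rowP vw0.
have vw i : (val v ord0 i == 0) && (val w ord0 i == 0).
  by rewrite -paddr_eq0 ?orthant_ge0 //; have := vw0 i; rewrite !mxE => ->.
by split; apply/val_inj/rowP => i; have /andP[/eqP ? /eqP ?] := vw i; rewrite mxE.
Qed.

HB.instance Definition _ := Choice_isMonomialDef.Build orthant
  orthantDA orthant0D orthantD0 orthant_unit.
HB.instance Definition _ := MonomialDef_isConomialDef.Build orthant orthantDC.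

Lemma axis_subproof (i : 'I_N) (alpha : {nonneg R}) :
  [forall j, 0 <= (alpha%:num *: delta_mx ord0 i : 'rV[R]_N) ord0 j].
Proof. by apply/forallP => j; rewrite !mxE mulr_ge0. Qed.
(* The exponent of x_i^alpha. *)
Definition axis (i : 'I_N) (alpha : {nonneg R}) : orthant :=
  Sub (alpha%:num *: delta_mx ord0 i) (axis_subproof i alpha).

Lemma diag_subproof (e : {nonneg R}) :
  [forall j, 0 <= (const_mx e%:num : 'rV[R]_N) ord0 j].
Proof. by apply/forallP => j; rewrite !mxE. Qed.
Definition diagv (e : {nonneg R}) : orthant :=
  Sub (const_mx e%:num) (diag_subproof e).

Lemma orthant_prod (v : orthant) :
  v = \big[orthantD/orthant0]_(i < N) axis i (NngNum (orthant_ge0 v i)).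
Proof.
apply/val_inj/rowP => j.
rewrite (big_morph val (id1 := 0) (op1 := +%R)) // summxE (bigD1 j) //=.
rewrite !mxE !eqxx mulr1 big1 ?addr0 // => i ij.
by rewrite !mxE /= [j == i]eq_sym (negbTE ij) mulr0.
Qed.

End MonoidRing.

Arguments orthant0 : clear implicits.
Arguments axis {R N} i alpha.
Arguments diagv {R} N e.

Section PersistenceModules.
Variables (k : fieldType) (R : realType) (N : nat).

Definition mring := malg (orthant R N) k.
HB.instance Definition _ := GRing.ComNzRing.on mring.

Definition xmon (v : orthant R N) : mring := mkmalgU v 1.

Lemma xmonD v w : xmon (orthantD v w) = xmon v * xmon w.
Proof. by rewrite /xmon malgM_def fgmulUU mulr1. Qed.

Lemma xmon0 : xmon (orthant0 R N) = 1.
Proof. by []. Qed.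

(* k embedded in B_N; it gives the k-vector space structure of a B_N-module. *)
Definition mscalar (a : k) : mring := mkmalgU (orthant0 R N) a.

(* A module M over B_N = k[R_{>=0}^N], with components M_a = [pm_part a]. *)
Record persmod := Persmod {
  pm_carrier :> lmodType mring;
  pm_part : 'rV[R]_N -> set pm_carrier;
  pm_part_subspace : forall a, pm_part a 0 /\
    forall c x y, pm_part a x -> pm_part a y -> pm_part a (mscalar c *: x + y);
  (* M is the direct sum of the M_a. *)
  pm_decomp : forall m : pm_carrier, exists! u : 'rV[R]_N -> pm_carrier,
    [/\ forall a, pm_part a (u a), finite_set [set a | u a != 0]
      & m = \sum_(a \in [set: 'rV[R]_N]) u a];
  (* x_i^alpha M_a is contained in M_(a + alpha e_i). *)
  pm_graded : forall (i : 'I_N) (alpha : {nonneg R}) a x, pm_part a x ->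
    pm_part (a + alpha%:num *: delta_mx ord0 i) (xmon (axis i alpha) *: x)
}.

Definition shifts (M : persmod) (v : orthant R N) : Prop :=
  forall a (x : M), pm_part a x -> pm_part (a + val v) (xmon v *: x).

Lemma shifts0 M : shifts M (orthant0 R N).
Proof. by move=> a x; rewrite addr0 xmon0 scale1r. Qed.

Lemma shiftsD M v w : shifts M v -> shifts M w -> shifts M (orthantD v w).
Proof.
move=> Mv Mw a x /Mw/Mv; rewrite xmonD -scalerA.
by rewrite (_ : val (orthantD v w) = val w + val v) ?addrA // addrC.
Qed.

Lemma pm_graded_xmon (M : persmod) v : shifts M v.
Proof.
rewrite [v]orthant_prod; elim/big_ind: _ => [|p q|i _]; first exact: shifts0.
  exact: shiftsD.
by move=> a x; exact: pm_graded.
Qed.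

Record pmor (M M' : persmod) := Pmor {
  pmor_fun :> {linear M -> M'};
  pmor_graded : forall a x, pm_part a x -> pm_part a (pmor_fun x)
}.

(* M(e) is M regraded by M(e)_a = M_(a + (e, ..., e)), so that the map
   underlying f(e) is the one underlying f. *)
Section Shift.
Variables (M : persmod) (e : R).

Definition shift_part (a : 'rV[R]_N) : set M := pm_part (a + const_mx e).

Lemma shift_subspace a : shift_part a 0 /\
  forall c x y, shift_part a x -> shift_part a y ->
    shift_part a (mscalar c *: x + y).
Proof. exact: pm_part_subspace. Qed.

Lemma shift_graded (i : 'I_N) (alpha : {nonneg R}) a x : shift_part a x ->
  shift_part (a + alpha%:num *: delta_mx ord0 i) (xmon (axis i alpha) *: x).
Proof. by rewrite /shift_part addrAC; exact: pm_graded. Qed.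

Lemma shift_decomp (m : M) : exists! u : 'rV[R]_N -> M,
  [/\ forall a, shift_part a (u a), finite_set [set a | u a != 0]
    & m = \sum_(a \in [set: 'rV[R]_N]) u a].
Proof.
pose s (a : 'rV[R]_N) := a + const_mx e.
pose s' (a : 'rV[R]_N) := a - const_mx e.
have sK : cancel s s' by move=> a; rewrite /s /s' addrK.
have s'K : cancel s' s by move=> a; rewrite /s /s' subrK.
have bs : bijective s by exists s'.
have bs' : bijective s' by exists s.
have fin (t t' : 'rV[R]_N -> 'rV[R]_N) (u : 'rV[R]_N -> M) : cancel t t' ->
    finite_set [set a | u a != 0] -> finite_set [set a | u (t a) != 0].
  move=> tK fu; apply: (@sub_finite_set _ _ (t' @` [set a | u a != 0])).
    by move=> a /= ua; exists (t a).
  exact: finite_image.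
have sum (t : 'rV[R]_N -> 'rV[R]_N) (u : 'rV[R]_N -> M) : bijective t ->
    \sum_(a \in [set: 'rV[R]_N]) u (t a) = \sum_(a \in [set: 'rV[R]_N]) u a.
  by move=> bt; rewrite -(reindex_fsbigT t).
have [u [[pu fu mu] uu]] := pm_decomp m.
exists (u \o s); split; first split.
- by move=> a; exact: pu.
- exact: fin sK fu.
- by rewrite mu -(sum s).
- move=> w [pw fw mw]; apply/funext => a /=.
  rewrite (uu (w \o s')) /= ?sK //; split.
  + by move=> b; have := pw (s' b); rewrite /shift_part -/(s _) s'K.
  + exact: fin s'K fw.
  + by rewrite mw -(sum s').
Qed.

Definition pm_shift : persmod :=
  Persmod shift_subspace shift_decomp shift_graded.

End Shift.

Definition shift_mor (M M' : persmod) (f : pmor M M') (e : R) :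
  pmor (pm_shift M e) (pm_shift M' e) :=
  @Pmor (pm_shift M e) (pm_shift M' e) (pmor_fun f)
    (fun a x ax => pmor_graded f ax).

Section Transition.
Variables (M : persmod) (e : {nonneg R}).

Definition xscale (v : orthant R N) (m : M) : M := xmon v *: m.

Lemma xscale_is_linear v : linear (xscale v).
Proof.
by move=> a x y; rewrite /xscale scalerDr !scalerA mulrC.
Qed.

HB.instance Definition _ v :=
  GRing.isLinear.Build mring M M *:%R (xscale v) (xscale_is_linear v).

(* On every M_a, the transition map M_a -> M_(a + (e, ..., e)) is the
   multiplication by the monomial of exponent (e, ..., e). *)
Definition Smor : pmor M (pm_shift M e%:num) :=
  @Pmor M (pm_shift M e%:num) (xscale (diagv N e))
    (pm_graded_xmon (diagv N e)).

End Transition.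

Definition interleaved (e : {nonneg R}) (M M' : persmod) : Prop :=
  exists (f : pmor M (pm_shift M' e%:num)) (g : pmor M' (pm_shift M e%:num)),
    (forall m : M, shift_mor g e%:num (f m) = Smor M (e%:num + e%:num)%:nng m) /\
    (forall m : M', shift_mor f e%:num (g m) = Smor M' (e%:num + e%:num)%:nng m).

Definition d_I (M M' : persmod) : \bar R :=
  ereal_inf [set e%:num%:E | e in [set e : {nonneg R} | interleaved e M M']].

End PersistenceModules.

Definition lev (R : realType) (N : nat) (a b : 'rV[R]_N) : Prop :=
  forall i, a ord0 i <= b ord0 i.

Section Total.
Variables (k : fieldType) (R : realType) (N : nat).
Local Notation idx := 'rV[R]_N.
Local Notation B := (mring k R N).

Record pfunctor := Pfunctor {
  pf_ob :> idx -> lmodType k;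
  pf_map : forall a b, lev a b -> {linear pf_ob a -> pf_ob b};
  pf_id : forall a (h : lev a a) x, pf_map h x = x;
  pf_comp : forall a b c (hab : lev a b) (hbc : lev b c) (hac : lev a c) x,
    pf_map hbc (pf_map hab x) = pf_map hac x
}.

Variable P : pfunctor.

Record dsum := Dsum {
  dsum_val :> forall c, P c;
  dsum_fin : finite_set [set c | dsum_val c != 0]
}.

Lemma dsumP (x y : dsum) : (forall c, x c = y c) -> x = y.
Proof.
case: x y => [x hx] [y hy] /= xy.
have E : x = y by exact: functional_extensionality_dep.
by subst y; congr Dsum; exact: Prop_irrelevance.
Qed.

HB.instance Definition _ := gen_eqMixin dsum.
HB.instance Definition _ := gen_choiceMixin dsum.

Lemma dsum0_fin : finite_set [set c : idx | (0 : P c) != 0].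
Proof. by rewrite (_ : mkset _ = set0) //; apply/seteqP; split=> c //=; rewrite eqxx. Qed.
Definition dsum0 : dsum := Dsum dsum0_fin.

Lemma dsumN_fin (x : dsum) : finite_set [set c | - x c != 0].
Proof. by apply: sub_finite_set (dsum_fin x) => c /=; rewrite oppr_eq0. Qed.
Definition dsumN (x : dsum) : dsum := Dsum (dsumN_fin x).

Lemma dsumD_fin (x y : dsum) : finite_set [set c | x c + y c != 0].
Proof.
apply: (@sub_finite_set _ _ ([set c | x c != 0] `|` [set c | y c != 0])).
  move=> c /= xyc; have [x0|] := eqVneq (x c) 0; last by left.
  by right; move: xyc; rewrite x0 add0r.
by rewrite finite_setU; split; exact: dsum_fin.
Qed.
Definition dsumD (x y : dsum) : dsum := Dsum (dsumD_fin x y).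

Lemma dsumDA : associative dsumD.
Proof. by move=> x y z; apply: dsumP => c /=; rewrite addrA. Qed.
Lemma dsumDC : commutative dsumD.
Proof. by move=> x y; apply: dsumP => c /=; rewrite addrC. Qed.
Lemma dsum0D : left_id dsum0 dsumD.
Proof. by move=> x; apply: dsumP => c /=; rewrite add0r. Qed.
Lemma dsumND : left_inverse dsum0 dsumN dsumD.
Proof. by move=> x; apply: dsumP => c /=; rewrite addNr. Qed.

HB.instance Definition _ :=
  GRing.isZmodule.Build dsum dsumDA dsumDC dsum0D dsumND.

Definition comp_at (c : idx) (x : dsum) : P c := x c.
Lemma comp_at_is_additive c : zmod_morphism (comp_at c).
Proof. by []. Qed.
HB.instance Definition _ c :=
  GRing.isZmodMorphism.Build dsum (P c) (comp_at c) (comp_at_is_additive c).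

Lemma dscale_fin (a : k) (x : dsum) : finite_set [set c | a *: x c != 0].
Proof.
apply: sub_finite_set (dsum_fin x) => c /=; apply: contraNN => /eqP ->.
by rewrite scaler0.
Qed.
Definition dscale (a : k) (x : dsum) : dsum := Dsum (dscale_fin a x).

Lemma lev_sub (v : orthant R N) (c : idx) : lev (c - val v) c.
Proof. by move=> i; rewrite !mxE gerBl orthant_ge0. Qed.

Lemma dmono_fin (v : orthant R N) (x : dsum) :
  finite_set [set c | pf_map P (lev_sub v c) (x (c - val v)) != 0].
Proof.
apply: (@sub_finite_set _ _ ((+%R^~ (val v)) @` [set c | x c != 0])).
  move=> c /= xc; exists (c - val v); rewrite ?subrK //=.
  by apply: contraNN xc => /eqP ->; rewrite linear0.
by apply: finite_image; exact: dsum_fin.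
Qed.

(* x^v acts by the transition maps P_(c - v) -> P_c. *)
Definition dmono (v : orthant R N) (x : dsum) : dsum := Dsum (dmono_fin v x).

Lemma pf_map_eq (x : dsum) a a' c (h : lev a c) (h' : lev a' c) :
  a = a' -> pf_map P h (x a) = pf_map P h' (x a').
Proof. by move=> E; subst a'; rewrite (Prop_irrelevance h h'). Qed.

Lemma dmono0 x : dmono (orthant0 R N) x = x.
Proof.
apply: dsumP => c /=.
have h : lev c c by [].
by rewrite (pf_map_eq _ _ h) ?pf_id //= subr0.
Qed.

Lemma dmonoD v w x : dmono v (dmono w x) = dmono (orthantD v w) x.
Proof.
apply: dsumP => c /=.
have h : lev (c - val v - val w) c.
  by move=> i; rewrite !mxE -addrA gerDl -opprD oppr_le0 addr_ge0 ?orthant_ge0.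
rewrite (pf_comp _ _ h); apply: pf_map_eq.
by rewrite /= opprD addrA.
Qed.

Lemma dmono_additive v : {morph dmono v : x y / x + y}.
Proof. by move=> x y; apply: dsumP => c /=; rewrite linearD. Qed.

Lemma dmonoZ v a x : dmono v (dscale a x) = dscale a (dmono v x).
Proof. by apply: dsumP => c /=; rewrite linearZ. Qed.

Lemma dmono00 v : dmono v 0 = 0.
Proof. by apply: dsumP => c /=; rewrite linear0. Qed.

Lemma dscaleDr a : {morph dscale a : x y / x + y}.
Proof. by move=> x y; apply: dsumP => c /=; rewrite scalerDr. Qed.

Lemma dscaleDl a b x : dscale (a + b) x = dscale a x + dscale b x.
Proof. by apply: dsumP => c /=; rewrite scalerDl. Qed.

Lemma dscaleA a b x : dscale a (dscale b x) = dscale (a * b) x.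
Proof. by apply: dsumP => c /=; rewrite scalerA. Qed.

Lemma dscale0l x : dscale 0 x = 0.
Proof. by apply: dsumP => c /=; rewrite scale0r. Qed.

Lemma dscale0r a : dscale a 0 = 0.
Proof. by apply: dsumP => c /=; rewrite scaler0. Qed.

Lemma dscale1 x : dscale 1 x = x.
Proof. by apply: dsumP => c /=; rewrite scale1r. Qed.

Definition dact (b : B) (x : dsum) : dsum :=
  \sum_(v <- msupp b) dscale (mcoeff v b) (dmono v x).

Lemma dactEw (d : {fset (orthant R N)}) b x : (msupp b `<=` d)%fset ->
  dact b x = \sum_(v <- d) dscale (mcoeff v b) (dmono v x).
Proof.
move=> le; rewrite /dact; apply: big_fset_incl => // v _ /mcoeff_outdom ->.
exact: dscale0l.
Qed.

Lemma dactU v a x : dact (mkmalgU v a) x = dscale a (dmono v x).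
Proof.
by rewrite (@dactEw [fset v]%fset) ?msuppU_le// big_seq_fset1 mcoeffUU.
Qed.

Lemma dactDl x : {morph dact^~ x : b b' / b + b'}.
Proof.
move=> b b'; pose d := (msupp b `|` msupp b')%fset.
rewrite (@dactEw d (b + b')) ?msuppD_le //.
rewrite (@dactEw d b) ?fsubsetUl // (@dactEw d b') ?fsubsetUr // -big_split /=.
by apply: eq_bigr => v _; rewrite mcoeffD dscaleDl.
Qed.

Lemma dact0 x : dact 0 x = 0.
Proof. by rewrite /dact msupp0 big_seq_fset0. Qed.

Lemma dactDr : right_distributive dact +%R.
Proof.
move=> b x y; rewrite /dact -big_split /=; apply: eq_bigr => v _.
by rewrite dmono_additive dscaleDr.
Qed.

Lemma dact1 : left_id 1 dact.
Proof. by move=> x; rewrite -(xmon0 k R N) dactU dscale1 dmono0. Qed.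

Lemma dactA b b' x : dact b (dact b' x) = dact (b * b') x.
Proof.
rewrite malgME (big_morph _ (dactDl x) (dact0 x)) {1}/dact.
apply: eq_bigr => v _.
rewrite (big_morph _ (dactDl x) (dact0 x)) [in LHS]/dact.
rewrite (big_morph _ (dmono_additive v) (dmono00 v)).
rewrite (big_morph _ (dscaleDr _) (dscale0r _)).
by apply: eq_bigr => w _; rewrite dactU dmonoZ dscaleA dmonoD.
Qed.

HB.instance Definition _ := GRing.Zmodule_isLmodule.Build B dsum
  dactA dact1 dactDr dactDl.

Definition dsum_part (a : idx) : set dsum :=
  [set x | forall c, c != a -> x c = 0].

Lemma dsum_part_subspace a : dsum_part a 0 /\
  forall c x y, dsum_part a x -> dsum_part a y ->
    dsum_part a (mscalar R N c *: x + y).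
Proof.
split=> // c x y ax ay b ba; rewrite -[_ *: x]/(dact _ x) dactU dmono0 /=.
by rewrite ax // ay // scaler0 addr0.
Qed.

Lemma dsum_single_fin (x : dsum) a :
  finite_set [set c | (if c == a then x c else 0) != 0].
Proof.
by apply: sub_finite_set (dsum_fin x) => c /=; case: ifP => //; rewrite eqxx.
Qed.
Definition dsum_single (x : dsum) a : dsum := Dsum (dsum_single_fin x a).

Lemma dsum_sumE (u : idx -> dsum) c : (forall a, dsum_part a (u a)) ->
  finite_set [set a | u a != 0] ->
  (\sum_(a \in [set: idx]) u a) c = u c c.
Proof.
move=> pu fu; pose d := fset_set [set a | u a != 0].
rewrite (fsbigTE (c |` d)%fset); last first.
  move=> a; rewrite !inE negb_or => /andP[_]; rewrite /d in_fset_set //.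
  by rewrite notin_setE /= => /negP/negPn/eqP.
rewrite -[LHS]/(comp_at c _) raddf_sum (big_fsetD1 c) /=; last by rewrite !inE eqxx.
rewrite big1_fset ?addr0 // => a; rewrite !inE => /andP[ac _] _.
by rewrite /comp_at pu // eq_sym.
Qed.

Lemma dsum_decomp (x : dsum) : exists! u : idx -> dsum,
  [/\ forall a, dsum_part a (u a), finite_set [set a | u a != 0]
    & x = \sum_(a \in [set: idx]) u a].
Proof.
exists (dsum_single x); split.
  have p a : dsum_part a (dsum_single x a) by move=> c /= /negbTE ->.
  have f : finite_set [set a | dsum_single x a != 0].
    apply: sub_finite_set (dsum_fin x) => a /=; apply: contraNN => /eqP xa.
    by apply/eqP/dsumP => c /=; case: eqP => // ->.
  by split=> //; apply: dsumP => c; rewrite dsum_sumE //= eqxx.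
move=> u [pu fu ->]; apply/funext => a; apply: dsumP => c /=.
by rewrite dsum_sumE //; case: eqVneq => [->//|ca]; rewrite pu.
Qed.

Lemma dsum_graded (i : 'I_N) (alpha : {nonneg R}) a x : dsum_part a x ->
  dsum_part (a + alpha%:num *: delta_mx ord0 i) (xmon k (axis i alpha) *: x).
Proof.
move=> ax c ca; rewrite -[_ *: x]/(dact _ x) dactU dscale1 /= ax ?linear0 //.
by apply: contraNN ca => /eqP <-; rewrite subrK.
Qed.

(* The B_N-module bigoplus_c P_c with its grading. *)
Definition direct_sum : persmod k R N :=
  Persmod dsum_part_subspace dsum_decomp dsum_graded.

End Total.

Section PersistentHomology.
Variables (k : fieldType) (R : realType) (N : nat) (Y : topologicalType).

(* Filtrations by subspaces of Y, with the inclusions as transition maps. *)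
Record filtration := Filtration {
  filt :> 'rV[R]_N -> set Y;
  filt_mono : forall a b, lev a b -> filt a `<=` filt b
}.

Variables (i : nat) (F : filtration).

Let hob (a : 'rV[R]_N) : lmodType k := homology k R i (F a).
Let hmor a b (h : lev a b) : {linear hob a -> hob b} :=
  hmap (incl (filt_mono (f := F) h)).

Lemma hmor_id a (h : lev a a) x : hmor h x = x.
Proof. by apply: hmap_id => t; exact: val_inj. Qed.

Lemma hmor_comp a b c (hab : lev a b) (hbc : lev b c) (hac : lev a c) x :
  hmor hbc (hmor hab x) = hmor hac x.
Proof. by apply: hmap_comp => t; exact: val_inj. Qed.

Definition homology_functor : pfunctor k R N := Pfunctor hmor_id hmor_comp.

Definition PH : persmod k R N := direct_sum homology_functor.

End PersistentHomology.

Section SublevelOffset.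
Variables (R : realType) (n : nat) (Y : metricType R).

(* The distance to the empty set is +oo. *)
Definition dist_to (A : set Y) (y : Y) : \bar R :=
  ereal_inf [set (mdist y x)%:E | x in A].

Definition sublevel (X : set Y) (f : X -> 'rV[R]_n) (a : 'rV[R]_n) : set Y :=
  [set set_val x | x in [set x : X | lev (f x) a]].

Section Filtration.
Variables (X : set Y) (f : X -> 'rV[R]_n).

(* An index in R^(n + 1) is the pair (a, b) of its first n coordinates and its
   last one. *)
Definition FSO_set (c : 'rV[R]_(n + 1)) : set Y :=
  [set y | (dist_to (sublevel f (lsubmx c)) y <= (rsubmx c ord0 ord0)%:E)%E].

Lemma FSO_mono c c' : lev c c' -> FSO_set c `<=` FSO_set c'.
Proof.
move=> cc' y /= yc; apply: (@le_trans _ _ (rsubmx c ord0 ord0)%:E); last first.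
  by rewrite lee_fin !mxE.
apply: le_trans yc; apply: ereal_inf_le_tmp => _ [_ [x fx <-] <-] /=.
exists (set_val x) => //; exists x => // i; apply: (le_trans (fx i)).
by rewrite !mxE.
Qed.

Definition FSO : filtration R (n + 1) Y := Filtration FSO_mono.

End Filtration.

(* Supremum in [0, +oo], so that the supremum of the empty set is 0. *)
Definition esup0 (A : set (\bar R)) : \bar R := ereal_sup (0%E |` A).

(* The norm of MathComp-Analysis on row vectors is the maximum norm. *)
Definition d_SO (X1 X2 : set Y) (f1 : X1 -> 'rV[R]_n) (f2 : X2 -> 'rV[R]_n) :
  \bar R :=
  let d x1 x2 :=
    (Num.max (mdist (set_val x1) (set_val x2)) `|f1 x1 - f2 x2|)%:E in
  maxe (esup0 [set ereal_inf [set d x1 x2 | x2 in [set: X2]] | x1 in [set: X1]])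
       (esup0 [set ereal_inf [set d x1 x2 | x1 in [set: X1]] | x2 in [set: X2]]).

End SublevelOffset.

(* Main.v *)
(** If [e] exceeds the distance of the two quadruples, every point of the
    sublevel set of [f1] at [a] is within [e] of a point of the sublevel set of
    [f2] at [a + e], so by the triangle inequality the first offset at [(a, b)]
    lies in the second one at [(a + e, b + e)], and symmetrically. These
    inclusions commute with those of the filtrations, so they induce an
    [e]-interleaving on homology. *)
Require Import Defs.
From HB Require Import structures.
From mathcomp Require Import all_boot all_order all_algebra.
From mathcomp Require Import all_classical all_reals.
From mathcomp Require Import interval_inference ereal topology normedtype.

Import Order.TTheory GRing.Theory Num.Theory.
Import numFieldNormedType.Exports.

Local Open Scope classical_set_scope.
Local Open Scope ring_scope.

Set Implicit Arguments.
Unset Strict Implicit.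
Unset Printing Implicit Defensive.

(* Maps between any [a], [b] with [a + v <= b], not only with [b = a + v], avoid
   transports along equalities of indices. *)
Record shiftnat (k : fieldType) (R : realType) (N : nat) (P Q : pfunctor k R N)
    (v : 'rV[R]_N) := Shiftnat {
  sn_map : forall a b, lev (a + v) b -> {linear P a -> Q b};
  sn_pre : forall a a' b (h : lev a a') (h' : lev (a' + v) b)
    (h'' : lev (a + v) b) x, sn_map h' (pf_map P h x) = sn_map h'' x;
  sn_post : forall a b b' (h : lev (a + v) b) (h' : lev b b')
    (h'' : lev (a + v) b') x, pf_map Q h' (sn_map h x) = sn_map h'' x
}.

Section ShiftedTransformation.
Variables (k : fieldType) (R : realType) (N : nat) (P Q : pfunctor k R N).
Variable e : {nonneg R}.
Local Notation v := (const_mx e%:num : 'rV[R]_N).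
Variable phi : shiftnat P Q v.

Lemma lev_subK (c : 'rV[R]_N) : lev (c - v + v) c.
Proof. by rewrite subrK. Qed.

(** The index occurs in the type of [x a], so index equations cannot simply be rewritten; after
    substitution, proof irrelevance identifies [h] and [h']. *)
Lemma sn_map_eq (x : dsum P) a a' c (h : lev (a + v) c) (h' : lev (a' + v) c) :
  a = a' -> sn_map phi h (x a) = sn_map phi h' (x a').
Proof. by move=> E; subst a'; rewrite (Prop_irrelevance h h'). Qed.

Lemma dsum_map_fin (x : dsum P) :
  finite_set [set c | sn_map phi (lev_subK c) (x (c - v)) != 0].
Proof.
apply: (@sub_finite_set _ _ ((+%R^~ v) @` [set c | x c != 0])).
  move=> c /= xc; exists (c - v); rewrite ?subrK //=.
  by apply: contraNN xc => /eqP ->; rewrite linear0.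
by apply: finite_image; exact: dsum_fin.
Qed.
(** As [pm_shift] changes only the grading, raising degrees by [v] means that the component at [c]
    comes from the one at [c - v]. *)
Definition dsum_map (x : dsum P) : dsum Q := Dsum (dsum_map_fin x).

Lemma dsum_mapD : {morph dsum_map : x y / x + y}.
Proof. by move=> x y; apply: dsumP => c /=; rewrite linearD. Qed.

Lemma dsum_map0 : dsum_map 0 = 0.
Proof. by apply: dsumP => c /=; rewrite linear0. Qed.

Lemma dsum_map_scale a x : dsum_map (dscale a x) = dscale a (dsum_map x).
Proof. by apply: dsumP => c /=; rewrite linearZ. Qed.

(** By naturality in source and target, both components at [c] are values of the one map of [phi]
    from degree [c - v - val w] to degree [c]. *)
Lemma dsum_map_mono w x : dsum_map (dmono w x) = dmono w (dsum_map x).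
Proof.
apply: dsumP => c /=.
have h : lev (c - val w - v + v) c by rewrite subrK; exact: lev_sub.
have h' : lev (c - v - val w + v) c by rewrite addrAC subrK; exact: lev_sub.
rewrite (sn_pre phi _ _ h') (sn_post phi _ _ h); apply: sn_map_eq.
by rewrite addrAC.
Qed.

Lemma dsum_map_is_linear :
  linear (dsum_map : direct_sum P -> pm_shift (direct_sum Q) e%:num).
Proof.
move=> b x y; rewrite dsum_mapD; congr (_ + _).
(* Ring elements act as finite combinations of monomials, so compatibility with scalars and
   monomials suffices. *)
rewrite -[b *: x]/(dact b x) -[RHS]/(dact b (dsum_map x)) /dact.
rewrite (big_morph _ dsum_mapD dsum_map0); apply: eq_bigr => w _.
by rewrite dsum_map_scale dsum_map_mono.
Qed.

HB.instance Definition _ := GRing.isLinear.Build (mring k R N) (direct_sum P)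
  (pm_shift (direct_sum Q) e%:num) *:%R dsum_map dsum_map_is_linear.

Lemma dsum_map_graded a (x : direct_sum P) :
  pm_part a x -> pm_part (p := pm_shift (direct_sum Q) e%:num) a (dsum_map x).
Proof.
move=> ax c ca /=; rewrite ax ?linear0 //.
by apply: contraNN ca => /eqP <-; rewrite subrK.
Qed.

Definition dsum_pmor : pmor (direct_sum P) (pm_shift (direct_sum Q) e%:num) :=
  @Pmor _ _ _ (direct_sum P) (pm_shift (direct_sum Q) e%:num) dsum_map
    dsum_map_graded.

End ShiftedTransformation.

(** Since [shift_mor] keeps the underlying map, both interleaving identities reduce to this one. In
    degree [c] both sides are the transition map of [P] from degree [c - 2e]. *)
Lemma dsum_map_comp (k : fieldType) (R : realType) (N : nat)
    (P Q : pfunctor k R N) (e : {nonneg R})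
    (phi : shiftnat P Q (const_mx e%:num)) (psi : shiftnat Q P (const_mx e%:num)) :
  (forall a b c (h : lev (a + const_mx e%:num) b) (h' : lev (b + const_mx e%:num) c)
     (h'' : lev a c) x, sn_map psi h' (sn_map phi h x) = pf_map P h'' x) ->
  forall m : direct_sum P, dsum_map psi (dsum_map phi m) =
    Smor (direct_sum P) (e%:num + e%:num)%:nng m.
Proof.
move=> psiphi m; rewrite -[RHS]/(dact _ _) dactU dscale1.
have E (c : 'rV[R]_N) : c - const_mx e%:num - const_mx e%:num =
    c - val (diagv N (e%:num + e%:num)%:nng).
  by apply/rowP => j; rewrite !mxE opprD addrA.
apply: dsumP => c /=.
have h : lev (c - const_mx e%:num - const_mx e%:num) c by rewrite E; exact: lev_sub.
by rewrite (psiphi _ _ _ _ _ h); exact: pf_map_eq.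
Qed.

Section ShiftedFiltrations.
Variables (k : fieldType) (R : realType) (N : nat) (Y : topologicalType).
Variables (i : nat).

Section Transformation.
Variables (F G : filtration R N Y) (v : 'rV[R]_N).
Hypothesis FG : forall c, F c `<=` G (c + v).

Lemma shift_subset a b : lev (a + v) b -> F a `<=` G b.
Proof. by move=> h y /FG; exact: filt_mono. Qed.

Definition shift_hmap a b (h : lev (a + v) b) :
    {linear homology k R i (F a) -> homology k R i (G b)} :=
  hmap (Defs.incl (shift_subset h)).

Lemma shift_hmap_pre a a' b (h : lev a a') (h' : lev (a' + v) b)
    (h'' : lev (a + v) b) (x : homology_functor k i F a) :
  shift_hmap h' (pf_map (homology_functor k i F) h x) = shift_hmap h'' x.
Proof. by apply: hmap_comp => t; exact: val_inj. Qed.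

Lemma shift_hmap_post a b b' (h : lev (a + v) b) (h' : lev b b')
    (h'' : lev (a + v) b') (x : homology_functor k i F a) :
  pf_map (homology_functor k i G) h' (shift_hmap h x) = shift_hmap h'' x.
Proof. by apply: hmap_comp => t; exact: val_inj. Qed.

Definition homology_shiftnat :
    shiftnat (homology_functor k i F) (homology_functor k i G) v :=
  @Shiftnat _ _ _ (homology_functor k i F) (homology_functor k i G) v
    shift_hmap shift_hmap_pre shift_hmap_post.

End Transformation.

Lemma interleaved_PH (F G : filtration R N Y) (e : {nonneg R}) :
  (forall c, F c `<=` G (c + const_mx e%:num)) ->
  (forall c, G c `<=` F (c + const_mx e%:num)) ->
  interleaved e (PH k i F) (PH k i G).
Proof.
move=> FG GF.
exists (dsum_pmor (homology_shiftnat FG)), (dsum_pmor (homology_shiftnat GF)).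
(* The composites and the transition maps all come from inclusions, which are determined by the
   underlying points of [Y]. *)
by split; apply: dsum_map_comp => a b c h h' h'' x;
  apply: hmap_comp => t; exact: val_inj.
Qed.

End ShiftedFiltrations.

Lemma FSO_shift (R : realType) (n : nat) (Y : metricType R) (X1 X2 : set Y)
    (f1 : X1 -> 'rV[R]_n) (f2 : X2 -> 'rV[R]_n) (e : R) :
  (forall x1, exists x2, mdist (set_val x1) (set_val x2) <= e /\
     `|f1 x1 - f2 x2| <= e) ->
  forall c, FSO f1 c `<=` FSO f2 (c + const_mx e).
Proof.
move=> H c y /= yc; rewrite /FSO_set /=.
have -> : rsubmx (c + const_mx e) ord0 ord0 = rsubmx c ord0 ord0 + e.
  by rewrite !mxE.
(* A nearest point need not exist, so the infima are compared: the second distance minus [e] is a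
   lower bound for the distances from [y] to points of the first sublevel set. *)
rewrite EFinD -leeBlDr //; apply: le_trans yc.
apply: le_ereal_inf_tmp => _ [_ [x1 fx1 <-] <-]; rewrite leeBlDr // -EFinD.
have [x2 [dx fx]] := H x1.
apply: (@le_trans _ _ (mdist y (set_val x2))%:E); last first.
  by rewrite lee_fin (le_trans (metric_triangle _ (set_val x1) _)) // lerD2l.
apply: ereal_inf_lbound; exists (set_val x2) => //; exists x2 => // j /=.
have := fx1 j; rewrite !mxE => fa.
have : `|(f1 x1 - f2 x2) ord0 j| <= e.
  apply: le_trans fx; rewrite [leRHS]mx_normrE.
  exact: (Order.TotalTheory.le_bigmax _ _ (ord0, j)).
rewrite !mxE distrC => /(le_trans (ler_norm _)); rewrite lerBlDr => fe.
by apply: (le_trans fe); rewrite addrC lerD.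
Qed.

Lemma lt_esup0 (R : realType) (T : Type) (g : T -> \bar R) (z : \bar R) x :
  (esup0 [set g t | t in [set: T]] < z)%E -> (g x < z)%E.
Proof.
by apply: le_lt_trans; apply: ereal_sup_ubound; right; exists x.
Qed.

Theorem theorem2p8p2 (k : fieldType) (R : realType) (n : nat) (hn : (0 < n)%N)
    (Y : metricType R) (X1 X2 : set Y)
    (f1 : X1 -> 'rV[R]_n) (f2 : X2 -> 'rV[R]_n) (i : nat) :
  (d_I (PH k i (FSO f1)) (PH k i (FSO f2)) <= d_SO f1 f2)%E.
Proof.
have d0 : (0 <= d_SO f1 f2)%E.
  (* The [0] adjoined by [esup0] ensures this even when [X1] and [X2] are empty. *)
  by rewrite le_max ereal_sup_ubound //; left.
have [dfin|] := ltP (d_SO f1 f2) +oo%E; last first.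
  by rewrite leye_eq => /eqP ->; rewrite leey.
(* The slack [e] makes the bound strict, so that each infimum in [d_SO] yields an actual point
   within [r]. *)
apply/lee_addgt0Pr => e e0.
have dE : d_SO f1 f2 = (fine (d_SO f1 f2))%:E by rewrite fineK // ge0_fin_numE.
pose r : {nonneg R} := NngNum (addr_ge0 (fine_ge0 d0) (ltW e0)).
have dr : (d_SO f1 f2 < r%:num%:E)%E by rewrite dE lte_fin /= ltrDl.
rewrite dE -EFinD; apply: ereal_inf_lbound; exists r => //.
move: dr; rewrite gt_max => /andP[d12 d21].
apply: interleaved_PH; apply: FSO_shift.
  move=> x1; have /ereal_inf_lt[_ [x2 _ <-]] := lt_esup0 x1 d12.
  by rewrite lte_fin gt_max => /andP[/ltW ? /ltW ?]; exists x2.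
move=> x2; have /ereal_inf_lt[_ [x1 _ <-]] := lt_esup0 x2 d21.
rewrite lte_fin gt_max => /andP[/ltW ? /ltW ?]; exists x1.
by rewrite metric_sym distrC.
Qed.
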